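(* The map $\xi:\mathcal{G}\longrightarrow \mathbb{N}_0$ defined by $$\xi(G)=f(G)+d(G)\quad\text{for every } G\in\mathcal{G}$$ is $d$-compatible.
   Context: All graphs are finite and simple; $\mathcal{G}$ is the set of all graphs and $\mathbb{N}_0$ the set of non-negative integers. A vertex $v$ of $G$ is free if the induced subgraph of $G$ on its neighbourhood $N_G(v)$ is complete (in particular an isolated vertex is free), and non-free otherwise; $f(G)$ is the number of free vertices of $G$. For a connected graph $H$, $\operatorname{diam}(H)$ is the maximum over $u,v\in V(H)$ of the length of a shortest path between $u$ and $v$. If $G$ has connected components $G_1,\ldots,G_t$ and $\mathfrak{i}(G)$ is the number of isolated vertices of $G$, put $d(G)=\mathfrak{i}(G)+\sum_{i=1}^t\operatorname{diam}(G_i)$. $G-v$ is the induced subgraph on $V(G)\setminus\{v\}$. $G_v$ is the graph with vertex set $V(G)$ and edge set $E(G)\cup\{\{u,w\}:\{u,w\}\subseteq N_G(v)\}$ ($u\neq w$). $K_t$ is the complete graph on $t$ vertices. A map $\psi:\mathcal{G}\to\mathbb{N}_0$ is called $d$-compatible if: (a) if $G=\dot\cup_{i=1}^t K_{n_i}$ is a disjoint union of complete graphs, where $n_i\ge1$ for every $1\le i\le t$, then $\psi(G)\le t+\sum_{i=1}^t n_i$; (b) if $G$ is not a disjoint union of complete graphs, then there exists a non-free vertex $v\in V(G)$ such that (1) $\psi(G-v)\ge\psi(G)$, and (2) $\psi(G_v)\ge\psi(G)$, and (3) $\psi(G_v-v)\ge\psi(G)-1$. *)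

(* Defs.v *)
From mathcomp Require Import all_boot.

Set Implicit Arguments.
Unset Strict Implicit.
Unset Printing Implicit Defensive.

Record sgraph := SGraph {
  vertex :> finType;
  edge : rel vertex;
  edge_sym : symmetric edge;
  edge_irrefl : irreflexive edge
}.

Definition graph_iso (G H : sgraph) : Prop :=
  exists2 h : G -> H, bijective h & forall x y, edge (h x) (h y) = edge x y.

Section Constructions.

Variable G : sgraph.
Implicit Types (A : {set G}) (v x y : G).

Definition nbhd v : {set G} := [set x | edge v x].

Definition induced_edge A : rel {x : G | x \in A} :=
  fun u w => edge (val u) (val w).

Fact induced_sym A : symmetric (@induced_edge A).
Proof. by move=> u w; apply: edge_sym. Qed.

Fact induced_irrefl A : irreflexive (@induced_edge A).
Proof. by move=> u; apply: edge_irrefl. Qed.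

Definition induced A : sgraph := SGraph (@induced_sym A) (@induced_irrefl A).

(* G - v *)
Definition del_vertex v : sgraph := induced (~: [set v]).

Definition completion_edge v : rel G :=
  fun x y => edge x y || [&& x != y, x \in nbhd v & y \in nbhd v].

Fact completion_sym v : symmetric (completion_edge v).
Proof.
move=> x y; rewrite /completion_edge edge_sym eq_sym.
by rewrite [(x \in _) && _]andbC.
Qed.

Fact completion_irrefl v : irreflexive (completion_edge v).
Proof. by move=> x; rewrite /completion_edge edge_irrefl eqxx. Qed.

(* G_v *)
Definition completion v : sgraph :=
  SGraph (@completion_sym v) (@completion_irrefl v).

Definition complete : bool := [forall x : G, forall y : G, (x != y) ==> edge x y].

Definition isolated v : bool := nbhd v == set0.

(* The length of a shortest path from x to y: [find] returns the first      *)
(* n < #|G| for which there is a walk of length n. The value is #|G| when x *)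
(* and y are not connected.                                                 *)
Definition dist x y : nat :=
  find (fun n => [exists p : n.-tuple G, path (@edge G) x p && (last x p == y)])
       (iota 0 #|G|).

(* Only meaningful when G is connected. *)
Definition diam : nat := \max_(x : G) \max_(y : G) dist x y.

Definition components : {set {set G}} :=
  equivalence_partition (connect (@edge G)) [set: G].

End Constructions.

Definition free (G : sgraph) (v : G) : bool := complete (induced (nbhd v)).

(* f(G) *)
Definition num_free (G : sgraph) : nat := #|[set v : G | free v]|.

(* i(G) *)
Definition num_isolated (G : sgraph) : nat := #|[set v : G | isolated v]|.

(* d(G) *)
Definition diam_sum (G : sgraph) : nat :=
  num_isolated G + \sum_(C in components G) diam (induced C).

Definition xi (G : sgraph) : nat := num_free G + diam_sum G.

Definition Kn_edge n : rel 'I_n := fun i j => i != j.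

Fact Kn_sym n : symmetric (@Kn_edge n).
Proof. by move=> i j; rewrite /Kn_edge eq_sym. Qed.

Fact Kn_irrefl n : irreflexive (@Kn_edge n).
Proof. by move=> i; rewrite /Kn_edge eqxx. Qed.

Definition Kn n : sgraph := SGraph (@Kn_sym n) (@Kn_irrefl n).

Section DisjointUnion.

Variables (t : nat) (F : 'I_t -> sgraph).

Definition dunion_edge : rel {i : 'I_t & F i} :=
  fun u v => (tag u == tag v) && edge (tagged u) (tagged_as u v).

Fact dunion_sym : symmetric dunion_edge.
Proof.
move=> [i x] [j y]; rewrite /dunion_edge /= [j == i]eq_sym.
by case: eqP y => //= <- y; rewrite !tagged_asE edge_sym.
Qed.

Fact dunion_irrefl : irreflexive dunion_edge.
Proof. by move=> [i x]; rewrite /dunion_edge /= tagged_asE edge_irrefl andbF. Qed.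

Definition dunion : sgraph := SGraph dunion_sym dunion_irrefl.

End DisjointUnion.

(* G is the disjoint union of the complete graphs on n 0, ..., n (t - 1)    *)
(* vertices, all of them nonempty.                                          *)
Definition is_dunion_complete (G : sgraph) t (n : 'I_t -> nat) : Prop :=
  (forall i, 0 < n i) /\ graph_iso G (dunion (fun i => Kn (n i))).

Definition d_compatible (psi : sgraph -> nat) : Prop :=
  (forall (G : sgraph) t (n : 'I_t -> nat),
     is_dunion_complete G n -> psi G <= t + \sum_(i < t) n i) /\
  (forall G : sgraph,
     ~ (exists t (n : 'I_t -> nat), is_dunion_complete G n) ->
     exists v : G,
       [/\ ~~ free v,
           psi (del_vertex v) >= psi G,
           psi (completion v) >= psi G &
           psi (@del_vertex (completion v) v) >= psi G - 1]).

(* Main.v *)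
Require Import Defs.
From mathcomp Require Import all_boot zify.

Set Implicit Arguments.
Unset Strict Implicit.
Unset Printing Implicit Defensive.

(** The sum of diameters is a maximum: choose a pair of connected vertices in
    each of some components ([probes]), and add up over the pairs the
    distance, counted as 1 for a pair of equal vertices ([span]). This value
    never exceeds [diam_sum] ([span_le_diam_sum]), and a suitable choice
    attains it ([diam_sum_span]). A graph operation inside one component is
    therefore controlled by exhibiting pairs in the new graph for this
    component alone ([diam_sum_local_change]).

    In a union of [t] complete graphs every pair counts 1, so [xi] is at most
    [t] plus the number of vertices. In any other graph some component has
    diameter [d > 1]; let [u = x 0, ..., x d = w] be a shortest path between
    two vertices of that component at distance [d]. The vertex to choose is an
    inner vertex [x k] of this path; it is not free. Completing its
    neighbourhood makes it free and shortens distances by at most 1, since a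
    shortest walk uses at most one edge inside a clique; so [xi] does not
    decrease. After that, deleting [x k] loses one free vertex and changes no
    distance between other vertices, so [xi] decreases by at most 1.

    It is the deletion of [x k] from the graph itself that decides which [x k]
    to take. Free vertices remain free under deletion, so the loss in the
    diameters has to be compensated. If some [x k] does not separate [u] from
    [w], deleting it does not shorten their distance. Suppose that every inner
    vertex separates [u] from [w]. Deleting [x 1] leaves a component of [u],
    worth at least 1, and one containing [x 2, ..., x d], worth at least [d -
    2] and at least 1. This suffices if [d = 2]. If [d > 2] it falls short by
    1, which is recovered when [x 2] becomes free, or when [x 1] has two non-
    adjacent neighbours other than [x 2] (such a branch lengthens one of the
    two components, or lies in a third one: [branch_probes]). If neither
    happens, the neighbours of [x 1] other than [x 2] form a clique and [x 2]
    has a neighbour besides [x 1] and [x 3]. Then [x 2] is the vertex to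
    delete: [d - 3] remains on the side of [w], 1 on the side of [u], [x 1]
    becomes free, and the branch at [x 2] gives the rest. *)

Notation conn G := (connect (@edge G)).

(** * Distances *)

Section Distance.
Variable G : sgraph.
Implicit Types x y z : G.

Lemma conn_sym : connect_sym (@edge G).
Proof. exact: sym_connect_sym (@edge_sym G). Qed.

Lemma dist_le_card x y : dist x y <= #|G|.
Proof. by rewrite /dist -[X in _ <= X](size_iota 0); apply: find_size. Qed.

Lemma dist_path x p : path (@edge G) x p -> dist x (last x p) <= size p.
Proof.
move=> ep; have [lt|/(leq_trans (dist_le_card _ _)) //] := ltnP (size p) #|G|.
rewrite leqNgt; apply/negP => /(before_find 0); rewrite nth_iota //.
by move/existsP; apply; exists (in_tuple p); rewrite ep eqxx.
Qed.

Lemma dist_witness x y : conn G x y ->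
  exists p, [/\ path (@edge G) x p, last x p = y & size p = dist x y].
Proof.
case/connectP=> p0 /shortenP[p ep Up _] ->.
have lt_p : size p < #|G|.
  by rewrite -[(size p).+1]/(size (x :: p)) -(card_uniqP Up) max_card.
have : has (fun n => [exists q : n.-tuple G,
    path (@edge G) x q && (last x q == last x p)]) (iota 0 #|G|).
  apply/hasP; exists (size p); first by rewrite mem_iota.
  by apply/existsP; exists (in_tuple p); rewrite ep eqxx.
move=> hasn; have := nth_find 0 hasn; rewrite nth_iota; last first.
  by rewrite has_find size_iota in hasn.
by case/existsP=> q /andP[eq /eqP lastq]; exists q; rewrite size_tuple.
Qed.

Lemma dist_disconnected x y : ~~ conn G x y -> dist x y = #|G|.
Proof.
move=> nxy; apply/eqP; rewrite eqn_leq dist_le_card /= leqNgt.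
apply: contra nxy; rewrite /dist -[X in _ < X](size_iota 0) -has_find.
case/hasP=> n _ /existsP[q /andP[eq /eqP <-]].
by apply/connectP; exists q.
Qed.

Lemma dist_refl x : dist x x = 0.
Proof. by apply/eqP; rewrite -leqn0; apply: (@dist_path x [::]). Qed.

(** Unconnected vertices are at distance [#|G|], the largest possible value,
    so the triangle inequality holds for all triples. *)
Lemma dist_triangle y x z : dist x z <= dist x y + dist y z.
Proof.
have [/dist_witness[p [ep lp <-]]|/dist_disconnected ->] := boolP (conn G x y);
  last exact: leq_trans (dist_le_card _ _) (leq_addr _ _).
have [/dist_witness[q [eq lq <-]]|/dist_disconnected ->] := boolP (conn G y z);
  last exact: leq_trans (dist_le_card _ _) (leq_addl _ _).
rewrite -size_cat -lq -lp -last_cat; apply: dist_path.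
by rewrite cat_path ep lp.
Qed.

Lemma dist_edge x y : edge x y -> dist x y <= 1.
Proof. by move=> exy; apply: (@dist_path x [:: y]); rewrite /= exy. Qed.

Lemma dist_gt0 x y : x != y -> 0 < dist x y.
Proof.
move=> nxy; have [/dist_witness[[|z p] [_ /= lp <-] //]|/dist_disconnected ->] :=
  boolP (conn G x y); first by rewrite lp eqxx in nxy.
by apply/card_gt0P; exists x.
Qed.

Lemma dist_gt1 x y : conn G x y -> x != y -> ~~ edge x y -> 1 < dist x y.
Proof.
case/dist_witness=> [[|z [|t p]] [/= ep lp <-] //].
  by rewrite lp eqxx.
by rewrite -lp (andP ep).1.
Qed.

Lemma dist_le1 x y : conn G x y -> dist x y <= 1 -> (x == y) || edge x y.
Proof.
move=> cxy; apply: contraTT; rewrite negb_or -ltnNge => /andP[].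
exact: dist_gt1.
Qed.

End Distance.

Lemma dist_hom (G H : sgraph) (f : G -> H) :
    {homo f : x y / edge x y} ->
  forall x y, conn G x y -> conn H (f x) (f y) /\ dist (f x) (f y) <= dist x y.
Proof.
move=> hf x y /dist_witness[p [ep <- <-]].
have ep' := homo_path hf ep; split; last by rewrite -(size_map f) -last_map dist_path.
by apply/connectP; exists (map f p) => //; rewrite last_map.
Qed.

Lemma dist_hom_le (G H : sgraph) (f : G -> H) :
    {homo f : x y / edge x y} -> #|H| <= #|G| ->
  forall x y, dist (f x) (f y) <= dist x y.
Proof.
move=> hf HG x y; have [/(dist_hom hf)[] //|/dist_disconnected ->] :=
  boolP (conn G x y); exact: leq_trans (dist_le_card _ _) HG.
Qed.

Lemma lift_walk (G : sgraph) (A : {set G}) (x : induced A) p :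
    path (@edge G) (val x) p -> {subset p <= A} ->
  exists2 q, path (@edge (induced A)) x q & map val q = p.
Proof.
elim: p x => [|y p IHp] x /= => [_ _|/andP[exy ep] sub]; first by exists [::].
have yA : y \in A by apply: sub; rewrite mem_head.
have [|q eq <-] := IHp (Sub y yA) ep.
  by move=> z zp; apply: sub; rewrite inE zp orbT.
by exists (Sub y yA :: q) => //=; rewrite eq andbT.
Qed.

Lemma dist_induced (G : sgraph) (A : {set G}) (x y : induced A) :
    (forall z, conn G (val x) z -> z \in A) -> conn G (val x) (val y) ->
  conn (induced A) x y /\ dist x y = dist (val x) (val y).
Proof.
move=> subA cxy; have [p [ep lp sp]] := dist_witness cxy.
have [z zp|q eq Eq] := lift_walk ep _.
  by apply: subA; apply: (path_connect ep); rewrite inE zp orbT.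
have lq : last x q = y by apply: val_inj; rewrite -lp -Eq last_map.
have cq : conn (induced A) x y by apply/connectP; exists q.
split=> //; apply/eqP; rewrite eqn_leq -sp -Eq size_map -{1}lq dist_path //=.
rewrite -[size q](size_map val) Eq sp.
by have [] := @dist_hom (induced A) G val (fun _ _ h => h) x y cq.
Qed.

(** * The sum of the diameters as a maximum over lists of pairs *)

(** Stated with roots, the condition that no two pairs come from the same
    component is visibly invariant under permutations of [s]. *)
Definition probes (G : sgraph) (s : seq (G * G)) : bool :=
  uniq [seq root (@edge G) p.1 | p <- s] && all (fun p => conn G p.1 p.2) s.

(** A trivial pair counts 1: an isolated vertex contributes 1 to [diam_sum],
    and any other component has diameter at least 1. *)
Definition span (G : sgraph) (s : seq (G * G)) : nat :=
  \sum_(p <- s) maxn 1 (dist p.1 p.2).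

Section DiamSum.
Variable G : sgraph.
Implicit Types (x y z : G) (s : seq (G * G)).

Let cG := @conn_sym G.

Definition component x : {set G} := [set y | conn G x y].

(** The first summand is 1 if the component is an isolated vertex, and 0
    otherwise. *)
Definition component_weight x : nat :=
  #|[set y | isolated y & root (@edge G) y == root (@edge G) x]|
  + diam (induced (component x)).

Lemma component_weight_root x :
  component_weight (root (@edge G) x) = component_weight x.
Proof.
rewrite /component_weight (root_root cG).
suff -> : component (root (@edge G) x) = component x by [].
apply/setP=> y; rewrite !inE -(root_connect cG) (root_root cG).
by rewrite (root_connect cG).
Qed.

Lemma diam_sum_roots :
  diam_sum G = \sum_(r in roots (@edge G)) component_weight r.
Proof.
rewrite big_split /diam_sum; congr (_ + _).
  rewrite /num_isolated -sum1_card.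
  rewrite [LHS](partition_big (root (@edge G)) (mem (roots (@edge G)))) /=.
    apply: eq_bigr => r /eqP Er; rewrite -sum1_card.
    by apply: eq_bigl => y; rewrite !inE Er.
  by move=> y _; apply: roots_root cG y.
rewrite -(big_imset (fun C : {set G} => diam (induced C))) /=.
  apply: eq_bigl => C; apply/imsetP/imsetP => [] [x Dx ->].
    exists (root (@edge G) x); first exact: roots_root cG x.
    apply/setP=> y; rewrite !inE -!(root_connect cG) (root_root cG) //.
  by exists x; rewrite ?inE //; apply/setP=> y; rewrite !inE.
move=> r t /eqP Er /eqP Et /setP/(_ t); rewrite !inE connect0.
by rewrite -(root_connect cG) Er Et => /eqP.
Qed.

Lemma isolated_connect x y : isolated x -> conn G x y -> x = y.
Proof.
move=> /eqP isox /connectP[[|z p] //= /andP[xz _] _].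
by have := in_set0 z; rewrite -isox inE xz.
Qed.

Lemma component_weight_attained x : exists p : G * G,
  [/\ conn G x p.1, conn G p.1 p.2, component_weight x = maxn 1 (dist p.1 p.2)
    & forall a b, conn G x a -> conn G x b -> dist a b <= dist p.1 p.2].
Proof.
pose C := component x.
have dC (a b : induced C) : dist a b = dist (val a) (val b).
  have [ca cb] : conn G x (val a) /\ conn G x (val b).
    by split; [have := valP a | have := valP b]; rewrite inE.
  apply: (dist_induced _ _).2; last by rewrite -(same_connect cG ca).
  by move=> z cz; rewrite inE; apply: connect_trans ca cz.
have xC : x \in C by rewrite inE connect0.
have C_gt0 : 0 < #|induced C| by apply/card_gt0P; exists (Sub x xC).
have [a Ea] := eq_bigmax (fun a : induced C => \max_(b : induced C) dist a b) C_gt0.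
have [b Eb] := eq_bigmax (fun b : induced C => dist a b) C_gt0.
have [ca cb] : conn G x (val a) /\ conn G x (val b).
  by split; [have := valP a | have := valP b]; rewrite inE.
have diamC : diam (induced C) = dist (val a) (val b) by rewrite -dC -Eb -Ea.
have maxC c d : conn G x c -> conn G x d -> dist c d <= dist (val a) (val b).
  move=> cc cd; have [cC dC'] : c \in C /\ d \in C by rewrite !inE.
  rewrite -diamC -[c]/(val (Sub c cC : induced C)) -[d]/(val (Sub d dC' : induced C)) -dC.
  apply: leq_trans (leq_bigmax (Sub c cC : induced C)).
  exact: (leq_bigmax (Sub d dC' : induced C)).
move: (val a) (val b) ca cb diamC maxC => u w cu cw diamC maxC.
exists (u, w); split=> //=; first by rewrite -(same_connect cG cu).
rewrite /component_weight diamC.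
have [isox | nisox] := boolP (isolated x).
  have -> : [set y | isolated y & root (@edge G) y == root (@edge G) x] = [set x].
    apply/setP=> y; rewrite !inE (root_connect cG); apply/andP/eqP=> [[isoy] | -> //].
    exact: isolated_connect.
  by rewrite cards1 -(isolated_connect isox cu) -(isolated_connect isox cw) dist_refl.
have -> : [set y | isolated y & root (@edge G) y == root (@edge G) x] = set0.
  apply/setP=> y; rewrite !inE (root_connect cG); apply: contraNF nisox => /andP[isoy].
  by move/(isolated_connect isoy) => <-.
rewrite cards0; case/set0Pn: nisox => y; rewrite inE => xy.
apply/esym/maxn_idPr; apply: leq_trans (maxC x y (connect0 _ _) (connect1 xy)).
by rewrite dist_gt0 //; apply: contraTneq xy => <-; rewrite edge_irrefl.
Qed.

Lemma span_le_diam_sum s : probes s -> span s <= diam_sum G.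
Proof.
case/andP=> Us cs; rewrite diam_sum_roots.
apply: (@leq_trans (\sum_(p <- s) component_weight (root (@edge G) p.1))).
  rewrite /span !big_seq; apply: leq_sum => p ps; rewrite component_weight_root.
  have [q [_ _ -> maxq]] := component_weight_attained p.1.
  rewrite geq_max leq_maxl leq_max maxq ?orbT //; exact: (allP cs).
rewrite -(big_map (fun p : G * G => root (@edge G) p.1) xpredT) big_uniq //.
rewrite [X in _ <= X](bigID (mem [seq root (@edge G) p.1 | p <- s])) /=.
apply: leq_trans (leq_addr _ _); rewrite leq_eqVlt; apply/orP; left; apply/eqP.
apply: eq_bigl => r; apply/idP/andP=> [rs | [] //]; split=> //.
by case/mapP: rs => p _ ->; apply: roots_root cG _.
Qed.

Lemma diam_sum_span : exists s, [/\ probes s, span s = diam_sum G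
  & forall x, exists2 p, p \in s & conn G x p.1 /\
      forall a b, conn G x a -> conn G x b -> dist a b <= dist p.1 p.2].
Proof.
have [f Hf] := fin_all_exists component_weight_attained.
exists [seq f r | r <- enum (roots (@edge G))]; split.
- apply/andP; split; last first.
    by apply/allP=> _ /mapP[r _ ->]; case: (Hf r).
  rewrite -map_comp (_ : map _ _ = enum (roots (@edge G))) ?enum_uniq //.
  rewrite -[RHS]map_id; apply/eq_in_map => r; rewrite mem_enum => /eqP Er /=.
  by have [/(rootP cG) <- _ _ _] := Hf r.
- rewrite diam_sum_roots /span big_map big_enum_cond /=.
  by apply: eq_big => [r|r _]; [rewrite andbT | case: (Hf r)].
move=> x; exists (f (root (@edge G) x)).
  by rewrite map_f // mem_enum; apply: roots_root cG x.
have [c1 _ _ maxf] := Hf (root (@edge G) x).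
have cx y : conn G x y = conn G (root (@edge G) x) y.
  by rewrite -!(root_connect cG) (root_root cG).
by split=> [|a b]; rewrite !cx //; apply: maxf.
Qed.

Lemma diam_sum_span_at x : exists u w s,
  [/\ conn G x u, probes ((u, w) :: s), span ((u, w) :: s) = diam_sum G
    & forall a b, conn G x a -> conn G x b -> dist a b <= dist u w].
Proof.
have [s [/andP[Us cs] spans /(_ x)[[u w] us [cu maxu]]]] := diam_sum_span.
have perms := perm_to_rem us; exists u, w, (rem (u, w) s); split=> //.
  by rewrite /probes -(perm_all _ perms) cs -(perm_uniq (perm_map _ perms)) Us.
by rewrite -spans /span -(perm_big _ perms).
Qed.

Lemma probes_cons p s : probes (p :: s) =
  [&& conn G p.1 p.2, all (fun q => ~~ conn G p.1 q.1) s & probes s].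
Proof.
rewrite /probes /=; set U := uniq _; set A := all _ s.
suff -> : (root (@edge G) p.1 \in [seq root (@edge G) q.1 | q <- s])
    = ~~ all (fun q => ~~ conn G p.1 q.1) s.
  by rewrite negbK; case: (conn G _ _); case: U; case: A; rewrite ?andbF ?andbT.
rewrite -has_predC; apply/mapP/hasP=> [[q qs Eq]|[q qs /= /negbNE cq]]; exists q => //=.
  by rewrite negbK -(root_connect cG) Eq.
exact/(rootP cG).
Qed.

Lemma span_cons p s : span (p :: s) = maxn 1 (dist p.1 p.2) + span s.
Proof. by rewrite /span big_cons. Qed.

Lemma span_nil : span (G := G) [::] = 0.
Proof. by rewrite /span big_nil. Qed.

End DiamSum.

(** * Isolating a vertex instead of deleting it *)

Section Detach.
Variables (G : sgraph) (v : G).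
Implicit Types x y z : G.

(** The graph without [v], on the same vertices as [G]: isolating [v] instead
    of deleting it lets distances before and after be compared without any
    change of type. It raises [xi] by at most 2 over the graph in which [v] is
    deleted, as [v] becomes one free and isolated vertex ([xi_detach]). *)
Definition detach_edge : rel G := fun x y => [&& edge x y, x != v & y != v].

Fact detach_sym : symmetric detach_edge.
Proof. by move=> x y; rewrite /detach_edge edge_sym [(x != v) && _]andbC. Qed.

Fact detach_irrefl : irreflexive detach_edge.
Proof. by move=> x; rewrite /detach_edge edge_irrefl. Qed.

Definition detach : sgraph := SGraph detach_sym detach_irrefl.

Lemma detach_sub : subrel detach_edge (@edge G).
Proof. by move=> x y /and3P[]. Qed.

Lemma dist_detach x y : dist x y <= @dist detach x y.
Proof. exact: (@dist_hom_le detach G id (@detach_sub)). Qed.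

End Detach.

Lemma freeP (G : sgraph) (v : G) :
  reflect {in nbhd v &, forall x y, x != y -> edge x y} (free v).
Proof.
apply: (iffP forallP) => [Fv x y Nx Ny nxy | Fv x].
  by have /forallP/(_ (Sub y Ny))/implyP := Fv (Sub x Nx); apply.
by apply/forallP=> y; apply/implyP=> nxy; apply: Fv; rewrite ?(valP x) ?(valP y).
Qed.

(** A walk either avoids [v] or is cut by [v] into two walks. *)
Lemma walk_detach (G : sgraph) (v x : G) p : path (@edge G) x p ->
  conn (detach v) x (last x p) \/ dist x v + dist v (last x p) <= size p.
Proof.
elim: p x => [|y p IHp] x /=; first by left; apply: connect0.
case/andP=> exy ep; have [Ev|xv] := eqVneq x v.
  right; rewrite Ev dist_refl add0n -Ev; apply: (@dist_path _ x (y :: p)).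
  by rewrite /= exy.
have [Ev|yv] := eqVneq y v.
  right; rewrite -Ev -[(size p).+1]add1n leq_add ?dist_edge //.
  exact: dist_path.
case: (IHp y ep) => [cy | le_p]; [left | right].
  by apply: connect_trans cy; apply: connect1; apply/and3P.
apply: leq_trans (_ : (dist x y + dist y v) + dist v (last y p) <= _).
  by rewrite leq_add2r dist_triangle.
by have := dist_edge exy; lia.
Qed.

Lemma dist_cut (G : sgraph) (v z x y : G) :
    conn (detach z) x y -> ~~ conn (detach v) x y ->
  dist x v + dist v y <= @dist (detach z) x y.
Proof.
case/dist_witness=> p [ep lp <-] ncut.
have := walk_detach v (sub_path (@detach_sub G z) ep).
by rewrite lp (negPf ncut) => -[].
Qed.

Section LocalChange.
Variables (G : sgraph) (e' : rel G) (s' : symmetric e') (i' : irreflexive e').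
Variable u : G.
Let H := SGraph s' i'.
Hypothesis subH : subrel e' (conn G).
Hypothesis eqH : forall x y, ~~ conn G u x -> e' x y = edge x y.

Lemma conn_local_change : subrel (conn H) (conn G).
Proof. exact: connect_sub. Qed.

Lemma path_local_change x p : ~~ conn G u x -> path e' x p = path (@edge G) x p.
Proof.
elim: p x => //= y p IHp x nux; rewrite eqH //; case: (boolP (edge x y)) => //= xy.
by rewrite IHp // -(same_connect_r (@conn_sym G) (connect1 xy)).
Qed.

Lemma dist_local_change x y : ~~ conn G u x -> conn G x y ->
  conn H x y /\ dist x y <= @dist H x y.
Proof.
move=> nux /connectP[p ep lp]; have cH : conn H x y.
  by apply/connectP; exists p; rewrite //= path_local_change.
split=> //; have [q [eq <- <-]] := dist_witness cH.
by apply: dist_path; rewrite -path_local_change.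
Qed.

(** The pairs [s] of the other components keep at least their value, so pairs
    [t] found in the changed component may be added to them. *)
Lemma diam_sum_local_change w s (t : seq (H * H)) :
    probes ((u, w) :: s) -> probes t -> all (fun p => conn G u p.1) t ->
  span s + span t <= diam_sum H.
Proof.
rewrite probes_cons => /and3P[_ /= nus ps] pt cut.
have [psH le_s] : probes (s : seq (H * H)) /\ span s <= span (s : seq (H * H)).
  elim: s nus ps => [|p s IHs]; first by rewrite !span_nil.
  rewrite /= => /andP[nup nus]; rewrite !probes_cons => /and3P[cp np ps].
  have [psH le_s] := IHs nus ps; have [cpH le_p] := dist_local_change nup cp.
  rewrite cpH psH !span_cons; split; last first.
    by rewrite leq_add // geq_max leq_maxl leq_max le_p orbT.
  rewrite andbT; apply: sub_all np => q; apply: contra; exact: conn_local_change.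
have ptH : probes (t ++ s).
  elim: t pt cut => //= p t IHt; rewrite !probes_cons => /and3P[cp np pt] /andP[cup cut].
  rewrite cp IHt // andbT all_cat np /=; apply: sub_all nus => q; apply: contra.
  by move/conn_local_change; apply: connect_trans.
apply: leq_trans (span_le_diam_sum ptH).
by rewrite [X in _ <= X]/span big_cat addnC leq_add.
Qed.

End LocalChange.

Lemma free_detach (G : sgraph) (v x : G) : free x -> free (x : detach v).
Proof.
move/freeP=> Fx; apply/freeP=> y z; rewrite !inE => /and3P[xy xv yv] /and3P[xz _ zv] yz.
by apply/and3P; split=> //; apply: Fx; rewrite ?inE.
Qed.

Lemma isolated_free (G : sgraph) (v : G) : isolated v -> free v.
Proof. by move/eqP=> nv; apply/freeP=> x y; rewrite nv inE. Qed.

Lemma isolated_detach (G : sgraph) (v : G) : isolated (v : detach v).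
Proof. by apply/eqP/setP=> x; rewrite !inE /= /detach_edge eqxx andbF. Qed.

Lemma detach_disconnected (G : sgraph) (v a : G) :
  v != a -> ~~ conn (detach v) v a.
Proof. by apply: contraNN => /(isolated_connect (isolated_detach v)) ->. Qed.

Section DeleteDetach.
Variables (G : sgraph) (v : G).
Let D := detach v.
Let R := del_vertex v.

Let valR (x : R) : val x != v.
Proof. by have := valP x; rewrite !inE. Qed.

Lemma num_free_detach : num_free D <= (num_free R).+1.
Proof.
rewrite /num_free (cardsD1 (v : D)) -(card_imset _ val_inj).
have le1 : (v \in [set x : D | free x]) <= 1 by case: (_ \in _).
rewrite -[X in _ <= X]add1n leq_add // subset_leq_card //; apply/subsetP=> x.
rewrite !inE => /andP[xv /freeP Fx].
have xR : x \in ~: [set v] by rewrite !inE.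
apply/imsetP; exists (Sub x xR : R) => //; rewrite inE; apply/freeP=> y z.
rewrite !inE => xy xz yz; suff /and3P[] : @edge D (val y) (val z) by [].
apply: Fx; last by rewrite (inj_eq val_inj).
  by rewrite inE; apply/and3P; split=> //; apply: valR.
by rewrite inE; apply/and3P; split=> //; apply: valR.
Qed.

Lemma conn_del (x y : R) : conn D (val x) (val y) -> conn R x y.
Proof.
case/connectP=> p; elim: p x => [|z p IHp] x /=; first by move=> _ /val_inj->.
case/andP=> /and3P[xz _ zv] ep lp; have zR : z \in ~: [set v] by rewrite !inE.
by apply: connect_trans (IHp (Sub z zR) ep lp); apply: connect1.
Qed.

Lemma diam_sum_detach : diam_sum D <= (diam_sum R).+1.
Proof.
have [x [w [s [vx ps <- _]]]] := diam_sum_span_at (v : D).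
have isov := isolated_detach v.
have Ex : x = v := esym (isolated_connect isov vx).
move: ps; rewrite probes_cons /= Ex => /and3P[vw nvs ps].
rewrite span_cons -(isolated_connect isov vw) /= dist_refl add1n ltnS.
suff [t [pt le_st _]] : exists t : seq (R * R), [/\ probes t, span s <= span t &
    s = [seq (val p.1, val p.2) | p <- t]].
  exact: leq_trans le_st (span_le_diam_sum pt).
elim: s ps nvs => [|[a b] s IHs]; first by exists [::]; rewrite !span_nil.
rewrite probes_cons /= => /and3P[ab nas ps] /andP[nva nvs].
have [t [pt le_st Est]] := IHs ps nvs.
have aR : a \in ~: [set v].
  by rewrite !inE; apply: contraNneq nva => ->; apply: connect0.
have bR : b \in ~: [set v].
  rewrite !inE; apply: contraNneq nva => Eb; rewrite Eb in ab.
  by rewrite (@conn_sym D).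
have cR : conn R (Sub a aR) (Sub b bR) by apply: conn_del.
have homR : {homo (val : R -> D) : x y / edge x y}.
  by move=> y z yz; apply/and3P; split; rewrite ?valR.
exists ((Sub a aR, Sub b bR) :: t); split; last by rewrite /= Est.
- rewrite probes_cons cR pt andbT /=; apply/allP=> q qt.
  apply: contra (allP nas (val q.1, val q.2) _); last first.
    by rewrite Est (map_f (fun p : R * R => (val p.1 : D, val p.2 : D))).
  by move/(dist_hom homR)=> [].
have [_ le_ab] := dist_hom homR cR.
by rewrite !span_cons leq_add // geq_max leq_maxl leq_max le_ab orbT.
Qed.

Lemma xi_detach : xi D <= (xi R).+2.
Proof.
by have := num_free_detach; have := diam_sum_detach; rewrite /xi; lia.
Qed.

End DeleteDetach.

(** * Completing a neighbourhood *)

Section Completion.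
Variables (G : sgraph) (v : G).
Implicit Types x y z : G.
Let Gv := completion v.

Lemma edge_completion : subrel (@edge G) (completion_edge v).
Proof. by move=> x y xy; rewrite /completion_edge xy. Qed.

Lemma completion_conn : subrel (completion_edge v) (conn G).
Proof.
move=> x y /orP[/connect1 //|/and3P[_]]; rewrite !inE => vx vy.
by apply: connect_trans (connect1 vy); apply: connect1; rewrite edge_sym.
Qed.

Lemma conn_completion x y : conn G x y -> conn Gv x y.
Proof. by apply: connect_sub => a b /edge_completion; apply: connect1. Qed.

Lemma completion_edge_out x y : ~~ conn G v x -> completion_edge v x y = edge x y.
Proof.
move=> nvx; rewrite /completion_edge [x \in _]inE.
suff /negPf-> : ~~ edge v x by rewrite andbF orbF.
by apply: contra nvx; apply: connect1.
Qed.

(** New edges join neighbours of [v]. A walk that uses them can go through [v]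
    from the start of the first to the end of the last, at the cost of at most
    one more step. *)
Lemma walk_completion x p : path (completion_edge v) x p ->
  dist x (last x p) <= size p \/ dist x v + dist v (last x p) <= (size p).+1.
Proof.
elim: p x => [|y p IHp] x /=; first by left; rewrite dist_refl.
case/andP=> xy /IHp le_p; case/orP: xy => [xy|/and3P[_]].
  have := dist_edge xy; have := dist_triangle y x (last y p).
  by have := dist_triangle y x v; lia.
rewrite !inE => vx vy; have := dist_edge vy; have := dist_triangle y v (last y p).
by have := dist_edge (etrans (edge_sym x v) vx); lia.
Qed.

Lemma dist_completion x y : conn G x y -> dist x y <= (@dist Gv x y).+1.
Proof.
move/conn_completion/dist_witness=> [p [ep <- <-]].
case: (walk_completion ep) => [|le_p]; first exact: leqW.
exact: leq_trans (dist_triangle v _ _) le_p.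
Qed.

(** If a free vertex [x] is adjacent to [v], its neighbours other than [v] are
    neighbours of [v], before and after the completion. *)
Lemma free_completion x : free x -> free (x : Gv).
Proof.
move/freeP=> Fx; apply/freeP=> y z; rewrite !inE => xy xz yz.
have [xv|nxv] := boolP (edge x v).
  have Nv a : completion_edge v x a -> (a == v) || edge v a.
    case/orP=> [xa|/and3P[_ _]]; last by rewrite inE => ->; rewrite orbT.
    by case: eqVneq => //= av; apply: Fx; rewrite ?inE // eq_sym.
  have /orP[/eqP Ey|vy] := Nv y xy; have /orP[/eqP Ez|vz] := Nv z xz.
  - by rewrite Ey Ez eqxx in yz.
  - by apply: edge_completion; rewrite Ey.
  - by apply: edge_completion; rewrite Ez edge_sym.
  by apply/orP; right; rewrite yz !inE vy.
have xE a : completion_edge v x a -> edge x a.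
  by case/orP=> // /and3P[_]; rewrite inE edge_sym (negPf nxv).
by apply: edge_completion; apply: Fx; rewrite ?inE ?xE.
Qed.

Lemma completion_free : free (v : Gv).
Proof.
have vE a : completion_edge v v a -> a \in nbhd v.
  by case/orP=> [|/and3P[] //]; rewrite inE.
apply/freeP=> y z; rewrite ![_ \in @nbhd Gv _]inE => /vE vy /vE vz yz.
by apply/orP; right; rewrite yz vy vz.
Qed.

Lemma num_free_completion : ~~ free v -> num_free G < num_free Gv.
Proof.
move=> nfv; apply/proper_card/properP; split.
  by apply/subsetP=> x; rewrite !inE; apply: free_completion.
by exists v; rewrite !inE ?completion_free.
Qed.

End Completion.

(** A walk through a free vertex can skip it. *)
Lemma conn_detach_free (G : sgraph) (v x y : G) :
  free v -> x != v -> y != v -> conn G x y -> conn (detach v) x y.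
Proof.
move=> /freeP Fv xv yv /connectP[p ep lp].
suff [Hx _] : (x != v -> conn (detach v) x y) /\
    (x = v -> forall z, edge v z -> conn (detach v) z y) by apply: Hx.
have nv z : edge v z -> z != v by apply: contraTneq => ->; rewrite edge_irrefl.
elim: p x {xv} ep lp => [|t p IHp] x /=.
  by move=> _ Ey; split=> [_|Ex]; [rewrite Ey connect0 | rewrite Ey Ex eqxx in yv].
case/andP=> xt /IHp IH /IH[IHn IHv]; split=> [xv|Ex z vz].
  have [Et|tv] := eqVneq t v; first by apply: (IHv Et); rewrite edge_sym -Et.
  by apply: connect_trans (IHn tv); apply: connect1; apply/and3P.
rewrite Ex in xt; have tv := nv t xt; have [<-|zt] := eqVneq t z; first exact: IHn.
apply: connect_trans (IHn tv); apply: connect1; apply/and3P; split=> //; last exact: nv.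
by apply: Fv; rewrite ?inE // eq_sym.
Qed.

Lemma num_free_detach_sub (G : sgraph) (v : G) : num_free G <= num_free (detach v).
Proof.
by apply/subset_leq_card/subsetP=> x; rewrite !inE; apply: free_detach.
Qed.

Lemma num_free_detach1 (G : sgraph) (v : G) :
  ~~ free v -> num_free G < num_free (detach v).
Proof.
move=> nfv; apply/proper_card/properP; split.
  by apply/subsetP=> x; rewrite !inE; apply: free_detach.
exists v; rewrite !inE //; apply: isolated_free; exact: isolated_detach.
Qed.

Lemma num_free_detach2 (G : sgraph) (v y : G) : ~~ free v -> ~~ free y -> y != v ->
  free (y : detach v) -> (num_free G).+2 <= num_free (detach v).
Proof.
move=> nfv nfy yv fy.
have [Fv Fy] : v \notin [set x | free x] /\ y \notin v |: [set x | free x].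
  by rewrite !inE (negPf yv).
have -> : (num_free G).+2 = #|y |: (v |: [set x | free x])|.
  by rewrite cardsU1 Fy cardsU1 Fv.
apply/subset_leq_card/subsetP=> x; rewrite !inE => /or3P[/eqP->|/eqP->|].
- exact: fy.
- by apply: isolated_free; apply: isolated_detach.
exact: free_detach.
Qed.


(** * Disjoint unions of complete graphs *)

Lemma dunion_completeE t (n : 'I_t -> nat) (a b : dunion (fun i => Kn (n i))) :
  edge a b = (tag a == tag b) && (a != b).
Proof.
rewrite /= /dunion_edge /= /Kn_edge -[a == b]/((tag a == tag b) && _).
by case: (tag a == tag b).
Qed.

Lemma card_dunion_complete (G : sgraph) t (n : 'I_t -> nat) :
  is_dunion_complete G n -> #|G| = \sum_(i < t) n i.
Proof.
case=> _ [h bijh _]; rewrite (bij_eq_card bijh) card_tagged sumnE big_map -big_enum /=.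
by apply: eq_bigr => i _; rewrite card_ord.
Qed.

Lemma xi_dunion_complete (G : sgraph) t (n : 'I_t -> nat) :
  is_dunion_complete G n -> xi G <= t + \sum_(i < t) n i.
Proof.
move=> GK; rewrite -(card_dunion_complete GK) /xi addnC leq_add ?max_card //.
case: GK => _ [h [g hK gK] homh]; pose c x := tag (h x).
have edgeE x y : edge x y = (c x == c y) && (x != y).
  by rewrite -homh dunion_completeE (inj_eq (can_inj hK)).
have connE x y : conn G x y = (c x == c y).
  apply/idP/eqP=> [/connectP[p]|cxy].
    elim: p x => [|z p IHp] x /=; first by move=> _ ->.
    by rewrite edgeE -andbA => /and3P[/eqP-> _ /IHp].
  have [->|nxy] := eqVneq x y; first exact: connect0.
  by apply: connect1; rewrite edgeE cxy eqxx.
have [s [/andP[Us cs] <- _]] := diam_sum_span G.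
have -> : span s = size s.
  rewrite /span -sum1_size !big_seq; apply: eq_bigr => p ps; apply/maxn_idPl.
  have [->|np] := eqVneq p.1 p.2; first by rewrite dist_refl.
  by apply: dist_edge; rewrite edgeE np andbT -connE; apply: (allP cs).
rewrite -(size_map (fun p : G * G => c p.1)).
apply: (@leq_trans #|'I_t|); last by rewrite card_ord.
suff /card_uniqP <- : uniq [seq c p.1 | p <- s] by apply: max_card.
elim: s Us {cs} => //= p s IHs /andP[nps /IHs ->]; rewrite andbT.
apply: contra nps => /mapP[q qs Eq]; apply/mapP; exists q => //.
by apply/(rootP (@conn_sym G)); rewrite connE Eq.
Qed.

(** The blocks are indexed by the roots of the components, and a vertex is sent
    to its rank in its component. *)
Lemma dunion_complete_of_diam1 (G : sgraph) :
    (forall x y, conn G x y -> dist x y <= 1) ->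
  exists t (n : 'I_t -> nat), is_dunion_complete G n.
Proof.
move=> diam1; have cG := @conn_sym G; pose r := root (@edge G).
pose R := roots (@edge G); pose C i := [set y | r y == enum_val (A := R) i].
have rR x : r x \in R by apply: roots_root cG x.
pose c x := enum_rank_in (rR x) (r x).
have cE x : enum_val (c x) = r x by rewrite /c enum_rankK_in.
have xC x : x \in C (c x) by rewrite inE cE.
exists #|R|, (fun i => #|C i|); split.
  move=> i; apply/card_gt0P; exists (enum_val i); rewrite inE.
  exact: enum_valP i.
pose h (x : G) : dunion (fun i => Kn #|C i|) :=
  Tagged (fun i => 'I_#|C i|) (enum_rank_in (xC x) x).
pose g (z : dunion (fun i => Kn #|C i|)) : G := enum_val (tagged z).
have hK : cancel h g by move=> x; rewrite /g /h /= enum_rankK_in.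
have injg : injective g.
  move=> [i a] [j b]; rewrite /g /= => Eab.
  have := enum_valP (A := C i) a; have := enum_valP (A := C j) b.
  rewrite !inE -Eab => /eqP ->.
  move/eqP/enum_val_inj/esym=> Ej; case: _ / Ej b Eab => b /enum_val_inj -> //.
exists h => [|x y]; first by exists g => // z; apply: injg; rewrite hK.
rewrite dunion_completeE (inj_eq (can_inj hK)) -(inj_eq enum_val_inj) !cE.
rewrite (root_connect cG); apply/andP/idP=> [[cxy nxy]|xy].
  by have := dist_le1 cxy (diam1 _ _ cxy); rewrite (negPf nxy).
by split; [apply: connect1 | apply: contraTneq xy => ->; rewrite edge_irrefl].
Qed.


(** * Geodesics *)

Definition geodesic (G : sgraph) (x : nat -> G) (d : nat) : Prop :=
  (forall i, i < d -> edge (x i) (x i.+1)) /\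
  (forall i j, i <= j <= d -> dist (x i) (x j) = j - i).

Lemma geodesic_exists (G : sgraph) (u w : G) : conn G u w ->
  exists x : nat -> G, [/\ x 0 = u, x (dist u w) = w & geodesic x (dist u w)].
Proof.
case/dist_witness=> p [ep lp sp]; pose x i := nth u (u :: p) i.
have xd : x (dist u w) = w by rewrite /x -sp nth_last.
have xE i : i < dist u w -> edge (x i) (x i.+1).
  by rewrite -sp => lt_i; have /pathP := ep; apply.
exists x; split=> //; split=> //.
have le_x i k : i + k <= dist u w -> dist (x i) (x (i + k)) <= k.
  elim: k => [|k IHk]; first by rewrite addn0 dist_refl.
  rewrite addnS => lt; have := dist_triangle (x (i + k)) (x i) (x (i + k).+1).
  by have := IHk (ltnW lt); have := dist_edge (xE _ lt); lia.
have le_ij k l : k <= l <= dist u w -> dist (x k) (x l) <= l - k.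
  by case/andP=> kl ld; have := @le_x k (l - k); rewrite subnKC //; apply.
move=> i j /andP[ij jd]; apply/eqP; rewrite eqn_leq le_ij ?ij //=.
(* A shorter walk from [x i] to [x j] would shorten the whole walk. *)
have := dist_triangle (x i) u w; have := dist_triangle (x j) (x i) w.
have := @le_ij 0 i; have := @le_ij j (dist u w).
rewrite xd jd leqnn (leq_trans ij jd) => /(_ isT) + /(_ isT).
by rewrite -[x 0]/u; lia.
Qed.

Section Diametral.
Variables (G : sgraph) (x : nat -> G) (d : nat).
Hypothesis geo : geodesic x d.

Local Notation u := (x 0).
Local Notation w := (x d).

Let edge_x := geo.1.
Let dist_x := geo.2.

Lemma geodesic_neq i j : i < j <= d -> x i != x j.
Proof.
case/andP=> ij jd; apply: contraTneq ij => Eij.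
by have := @dist_x i j; rewrite Eij dist_refl; lia.
Qed.

Lemma geodesic_conn i : i <= d -> conn G u (x i).
Proof.
elim: i => [|i IHi] id; first exact: connect0.
exact: connect_trans (IHi (ltnW id)) (connect1 (edge_x id)).
Qed.

Lemma geodesic_inner_nonfree k : 0 < k < d -> ~~ free (x k).
Proof.
case/andP=> k0 kd; have Ek : k.-1.+1 = k by rewrite prednK.
have [lk ll] : k.-1 < d /\ k.-1 <= k.+1 by lia.
apply/freeP=> Fk; have := @dist_x k.-1 k.+1; rewrite ll kd => /(_ isT).
suff /dist_edge : edge (x k.-1) (x k.+1) by lia.
apply: Fk; rewrite ?inE ?edge_x //; last by apply: geodesic_neq; lia.
by rewrite edge_sym -{2}Ek edge_x.
Qed.

Lemma geodesic_start_neq k : 0 < k < d -> u != x k.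
Proof. by case/andP=> k0 kd; apply: geodesic_neq; rewrite k0 ltnW. Qed.

Lemma geodesic_end_neq k : 0 < k < d -> w != x k.
Proof. by case/andP=> k0 kd; rewrite eq_sym geodesic_neq // kd leqnn. Qed.

Lemma geodesic_conn_left i k : i < k <= d -> conn (detach (x k)) u (x i).
Proof.
case/andP=> + kd; elim: i => [|i IHi] ik; first exact: connect0.
apply: connect_trans (IHi (ltnW ik)) (connect1 _); apply/and3P.
by split; [apply: edge_x | apply: geodesic_neq | apply: geodesic_neq]; lia.
Qed.

Lemma geodesic_conn_right i k : k < i <= d -> conn (detach (x k)) (x i) w.
Proof.
case/andP=> ki id; rewrite -(subnKC id).
suff right m : m <= d - i -> conn (detach (x k)) (x i) (x (i + m)) by apply: right.
elim: m => [|m IHm] le_m; first by rewrite addn0 connect0.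
apply: connect_trans (IHm (ltnW le_m)) (connect1 _); rewrite addnS; apply/and3P.
by split; [apply: edge_x | rewrite eq_sym geodesic_neq
           | rewrite eq_sym geodesic_neq]; lia.
Qed.

Lemma geodesic_dist_end k : k <= d -> d - k <= dist (x k) w.
Proof. by move=> kd; rewrite dist_x // kd leqnn. Qed.

(** The next vertex [x k.+1] separates [u] from [w], and [p] is on the side
    of [u] because it is adjacent to [x k]; so every walk from [p] to [w]
    meets [x k.+1], which is at distance [d - k.+1] from [w]. *)
Lemma dist_branch k p : k < d -> ~~ conn (detach (x k.+1)) u w ->
    edge (x k) p -> p != x k.+1 -> conn (detach (x k)) p w ->
  d - k <= @dist (detach (x k)) p w.
Proof.
move=> kd sep kp np cpw.
have npw : ~~ conn (detach (x k.+1)) p w.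
  apply: contra sep; apply: connect_trans.
  apply: connect_trans (geodesic_conn_left (i := k) _) (connect1 _).
    by rewrite leqnn.
  by apply/and3P; split=> //; apply: geodesic_neq; rewrite leqnn.
have := dist_cut cpw npw; have := dist_gt0 np; have := geodesic_dist_end kd.
by move: kd; clear; lia.
Qed.

(** In the graph without [x k], the walk [x k.+1 .. x d] has length
    [d - k.+1] and the component of [u] contributes at least 1. One more is
    gained from [p]: if [p] reaches [w], it is farther from [w] than [x k.+1]
    by [dist_branch]; if [p] lies in the component of [u], that component is
    not complete because of [q]; otherwise [p] lies in a third component. *)
Lemma branch_probes k p q : 0 < k < d ->
    ~~ conn (detach (x k)) u w -> ~~ conn (detach (x k.+1)) u w ->
    edge (x k) p -> p != x k.+1 ->
    conn (detach (x k)) u q -> p != q -> ~~ edge p q ->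
  exists t : seq (detach (x k) * detach (x k)),
    [/\ probes t, all (fun p => (x k != p.1) && conn G u p.1) t
      & d - k < span t].
Proof.
move=> kd sepk sepk1 kp np uq pq npq; set D := detach (x k).
have cD := @conn_sym D; have uk := geodesic_start_neq kd.
have pk : x k != p by apply: contraTneq kp => <-; rewrite edge_irrefl.
have /andP[k0 ltkd] := kd; have lekd := ltnW ltkd.
have up : conn G u p := connect_trans (geodesic_conn lekd) (connect1 kp).
have x1k : x k != x k.+1 by apply: geodesic_neq; rewrite leqnn.
have x1w : conn D (x k.+1) w by apply: geodesic_conn_right; rewrite leqnn.
have ux1G := geodesic_conn ltkd.
have le_x1 : d - k.+1 <= @dist D (x k.+1) w.
  exact: leq_trans (geodesic_dist_end ltkd) (dist_detach _ _ _).
have ux1 : ~~ conn D u (x k.+1).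
  by apply: contra sepk => cx1; apply: connect_trans cx1 x1w.
have [pw|npw] := boolP (conn D p w).
  exists [:: (u, u); (p, w)]; split.
  - rewrite !probes_cons /= connect0 pw !andbT /=.
    by apply: contra sepk => cup; apply: connect_trans cup pw.
  - by rewrite /= eq_sym uk pk connect0 up.
  have := dist_branch ltkd sepk1 kp np pw; rewrite !span_cons span_nil /=.
  set d1 := @dist D p w; set d2 := @dist D u u => le1.
  by have := leq_maxr 1 d1; have := leq_maxl 1 d2; move: ltkd le1; clear; lia.
have px1 : ~~ conn D p (x k.+1).
  by apply: contra npw => cx1; apply: connect_trans cx1 x1w.
have [cup|ncup] := boolP (conn D u p).
  have cpq : conn D p q by rewrite -(same_connect cD cup).
  exists [:: (p, q); (x k.+1, w)]; split.
  - by rewrite !probes_cons /= cpq x1w px1.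
  - by rewrite /= pk up x1k ux1G.
  have : 1 < @dist D p q.
    by apply: dist_gt1 => //; apply: contra npq; apply: detach_sub.
  rewrite !span_cons span_nil /=; set d1 := @dist D p q => lt1.
  have := leq_maxr 1 d1; set d2 := @dist D _ _ in le_x1 *.
  by have := leq_maxr 1 d2; move: ltkd lt1 le_x1; clear; lia.
exists [:: (u, u); (p, p); (x k.+1, w)]; split.
- by rewrite !probes_cons /= !connect0 x1w px1 ncup ux1.
- by rewrite /= eq_sym uk pk up x1k !connect0 ux1G.
rewrite !span_cons span_nil /=; set d2 := @dist D (x k.+1) w in le_x1 *.
set d3 := @dist D u u; set d4 := @dist D p p.
have := leq_maxl 1 d3; have := leq_maxl 1 d4; have := leq_maxr 1 d2.
by move: ltkd le_x1; clear; lia.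
Qed.

(** * Inner vertices of a diametral geodesic *)

Variable s : seq (G * G).
Hypothesis d_gt1 : 1 < d.
Hypothesis probes_s : probes ((u, w) :: s).
Hypothesis span_s : span ((u, w) :: s) = diam_sum G.

Let dist_uw : dist u w = d.
Proof. by rewrite dist_x ?leqnn // subn0. Qed.

Let conn_uw : conn G u w := geodesic_conn (leqnn d).

Let diam_sumE : diam_sum G = d + span s.
Proof. by rewrite -span_s span_cons /= dist_uw (maxn_idPr (ltnW d_gt1)). Qed.

Let conn_out k a : k <= d -> ~~ conn G u a -> ~~ conn G (x k) a.
Proof. by move=> kd; rewrite -(same_connect (@conn_sym G) (geodesic_conn kd)). Qed.

Let detach_edge_out k a b : k <= d -> ~~ conn G u a ->
  edge a b = [&& edge a b, a != x k & b != x k].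
Proof.
move=> kd nua; case: (boolP (edge a b)) => //= ab; apply/esym/andP.
have ck := geodesic_conn kd; split; apply: contraNneq nua => E; first by rewrite E.
by apply: connect_trans ck _; rewrite -E (@conn_sym G) connect1.
Qed.

Let diam_sum_completion k (t : seq (completion (x k) * completion (x k))) :
    k <= d -> probes t -> all (fun p => conn G u p.1) t ->
  span s + span t <= diam_sum (completion (x k)).
Proof.
move=> kd; apply: (diam_sum_local_change (@completion_conn _ _) _ probes_s).
by move=> a b /(conn_out kd); apply: completion_edge_out.
Qed.

Let diam_sum_detach k (t : seq (detach (x k) * detach (x k))) :
    k <= d -> probes t -> all (fun p => conn G u p.1) t ->
  span s + span t <= diam_sum (detach (x k)).
Proof.
move=> kd; apply: (diam_sum_local_change _ _ probes_s) => [a b /detach_sub|a b nua].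
  exact: connect1.
by rewrite (detach_edge_out _ kd nua).
Qed.

Let diam_sum_detach_completion k (H := completion (x k))
    (t : seq (detach (x k : H) * detach (x k : H))) :
    k <= d -> probes t -> all (fun p => conn G u p.1) t ->
  span s + span t <= diam_sum (detach (x k : H)).
Proof.
move=> kd; apply: (diam_sum_local_change _ _ probes_s) => [a b /and3P[+ _ _]|a b nua].
  exact: completion_conn.
by rewrite (detach_edge_out _ kd nua) -(completion_edge_out _ (conn_out kd nua)).
Qed.

(** The distance from [u] to [w] drops by at most 1, and [x k] becomes free. *)
Lemma xi_completion k : 0 < k < d -> xi G <= xi (completion (x k)).
Proof.
move=> kd; have := num_free_completion (geodesic_inner_nonfree kd).
have {}kd : k <= d by case/andP: kd => _ /ltnW.
have cuw := conn_completion (x k) conn_uw.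
have := @diam_sum_completion k [:: (u, w)] kd.
rewrite probes_cons span_cons span_nil /= cuw connect0 => /(_ isT isT).
have := dist_completion (x k) conn_uw.
rewrite /xi diam_sumE dist_uw; set d' := dist _ _ => le_d.
by have := leq_maxr 1 d'; lia.
Qed.

(** As [x k] is free in its completion and differs from [u] and [w], deleting
    it afterwards disconnects nothing and costs one free vertex. *)
Lemma xi_completion_del k (H := completion (x k)) : 0 < k < d ->
  xi G <= (xi (del_vertex (x k : H))).+1.
Proof.
move=> kd; have := num_free_completion (geodesic_inner_nonfree kd).
have := num_free_detach_sub (x k : H); have := xi_detach (x k : H).
have [uk wk] := (geodesic_start_neq kd, geodesic_end_neq kd).
have {}kd : k <= d by case/andP: kd => _ /ltnW.
have cuw : conn (detach (x k : H)) u w.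
  apply: conn_detach_free => //; first exact: completion_free.
  exact: conn_completion.
have := @diam_sum_detach_completion k [:: (x k, x k); (u, w)] kd.
rewrite !probes_cons !span_cons span_nil /= connect0 cuw geodesic_conn // connect0 andbT.
rewrite (detach_disconnected (G := H)) 1?eq_sym // => /(_ isT isT).
have := dist_detach (x k : H) u w; have := dist_completion (x k) conn_uw.
rewrite /xi diam_sumE dist_uw -/H; set d1 := dist _ _; set d2 := dist _ _ => le_d le_d1.
have := leq_maxr 1 d2; have := leq_maxl 1 (@dist (detach (x k : H)) (x k) (x k)).
by lia.
Qed.

(** Of the 2 lost in [xi_detach], the pair at the isolated vertex [x k], added
    to [t] here, makes up 1. The strict inequality makes up the other, and
    [x k] itself, which becomes free, helps to reach it. *)
Lemma xi_del_probes k (t : seq (detach (x k) * detach (x k))) :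
    k <= d -> probes t -> all (fun p => (x k != p.1) && conn G u p.1) t ->
    d + num_free G < span t + num_free (detach (x k)) ->
  xi G <= xi (del_vertex (x k)).
Proof.
move=> kd pt; rewrite all_predI => /andP[nt ct].
have {}pt : probes (G := detach (x k)) ((x k, x k) :: t).
  rewrite probes_cons connect0 pt andbT /=; apply: sub_all nt => p.
  exact: detach_disconnected.
have := diam_sum_detach kd pt; rewrite /= geodesic_conn // ct => /(_ isT).
have := xi_detach (x k); rewrite span_cons /xi diam_sumE.
have := leq_maxl 1 (@dist (detach (x k)) (x k) (x k)).
by rewrite /=; lia.
Qed.

(** Deleting a vertex that does not separate [u] from [w] does not decrease
    their distance. *)
Lemma xi_del_nonseparating k :
  0 < k < d -> conn (detach (x k)) u w -> xi G <= xi (del_vertex (x k)).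
Proof.
move=> kd cuw; have lt_f := num_free_detach1 (geodesic_inner_nonfree kd).
apply: (@xi_del_probes k [:: (u, w)]); first by case/andP: kd => _ /ltnW.
- by rewrite probes_cons /= cuw.
- by rewrite /= eq_sym geodesic_start_neq // connect0.
have := dist_detach (x k) u w; rewrite dist_uw span_cons span_nil /=.
by set d' := dist _ _ => le_d; have := leq_maxr 1 d'; lia.
Qed.

Section Separating.
Hypothesis sep : forall k, 0 < k <= d -> ~~ conn (detach (x k)) u w.

Let d1 : 0 < 1 < d := d_gt1.
Let sep1 : ~~ conn (detach (x 1)) u w := sep (k := 1) (ltnW d_gt1).
Let sep2 : ~~ conn (detach (x 2)) u w := sep (k := 2) d_gt1.
Let nonfree1 := geodesic_inner_nonfree d1.
Let edge1u : edge (x 1) u.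
Proof. by rewrite edge_sym edge_x // ltnW. Qed.
Let neq12 : x 1 != x 2.
Proof. exact: geodesic_neq. Qed.

Let conn_2w : conn (detach (x 1)) (x 2) w.
Proof. exact: geodesic_conn_right. Qed.

Let nconn_u2 : ~~ conn (detach (x 1)) u (x 2).
Proof. by apply: contra sep1 => cx2; apply: connect_trans cx2 conn_2w. Qed.

(** The guaranteed value is 1 less than [d], except when [d = 2]. *)
Lemma separating_probes : exists t : seq (detach (x 1) * detach (x 1)),
  [/\ probes t, all (fun p => (x 1 != p.1) && conn G u p.1) t
    & maxn 2 (d - 1) <= span t].
Proof.
exists [:: (u, u); (x 2, w)]; split.
- by rewrite !probes_cons /= connect0 conn_2w nconn_u2.
- by rewrite /= eq_sym geodesic_start_neq // neq12 connect0 geodesic_conn.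
have := leq_trans (geodesic_dist_end (k := 2) d_gt1) (dist_detach (x 1) _ _).
set D := detach (x 1); rewrite !span_cons span_nil /=.
set d2 := @dist D (x 2) w; set d3 := @dist D u u.
have := leq_maxl 1 d3; have := leq_maxr 1 d2; have := leq_maxl 1 d2.
by rewrite geq_max; clear; lia.
Qed.

(** [branch_probes] applies at [x 1]: if [p] lies in the component of [u], with
    [q] as the branch, not adjacent to [p]; otherwise with [p] as the branch,
    not adjacent to [u]. *)
Lemma xi_del_first p q : edge (x 1) p -> edge (x 1) q ->
    p != x 2 -> q != x 2 -> p != q -> ~~ edge p q ->
  xi G <= xi (del_vertex (x 1)).
Proof.
move=> xp xq p2 q2 pq npq; have lt_f := num_free_detach1 nonfree1.
have [t [pt nt lt_t]] : exists t : seq (detach (x 1) * detach (x 1)),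
    [/\ probes t, all (fun p => (x 1 != p.1) && conn G u p.1) t & d - 1 < span t].
  have [cup|ncup] := boolP (conn (detach (x 1)) u p).
    by apply: (@branch_probes 1 q p); rewrite // 1?eq_sym // edge_sym.
  apply: (@branch_probes 1 p u) => //.
    by apply: contraNneq ncup => ->; apply: connect0.
  apply: contra ncup => pu; apply: connect1; apply/and3P; split.
  - by rewrite edge_sym.
  - exact: geodesic_start_neq.
  by apply: contraTneq xp => ->; rewrite edge_irrefl.
apply: (xi_del_probes _ pt nt); first exact: ltnW.
by move: lt_t lt_f; clear; lia.
Qed.

(** If the neighbours of [x 1] other than [x 2] form a clique, [x 1] becomes
    free when [x 2] is deleted. Unless [x 2] becomes free when [x 1] is
    deleted, it has a neighbour besides [x 1] and [x 3], and this is the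
    branch to which [branch_probes] applies at [x 2]. *)
Lemma xi_del_second : 2 < d ->
    (forall p q, edge (x 1) p -> edge (x 1) q -> p != x 2 -> q != x 2 ->
       (p == q) || edge p q) ->
    ~~ free (x 2 : detach (x 1)) ->
  xi G <= xi (del_vertex (x 2)).
Proof.
move=> d3 clique1 nfr2; have d2 : 0 < 2 < d by [].
have nonfree2 := geodesic_inner_nonfree d2.
have u2 : u != x 2 by apply: geodesic_start_neq.
have nux : ~~ edge u (x 2) by apply/negP=> /dist_edge; rewrite dist_x // ltnW.
have n1 y : edge (x 2) y -> y != x 1 -> ~~ edge y (x 1).
  move=> x2y y1; rewrite edge_sym; apply: contra nconn_u2 => x1y.
  have y2 : y != x 2 by apply: contraTneq x2y => ->; rewrite edge_irrefl.
  case/orP: (clique1 u y edge1u x1y u2 y2) => [/eqP Eu|uy].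
    by rewrite Eu edge_sym x2y in nux.
  apply: (@connect_trans _ _ y); apply: connect1; apply/and3P; split=> //.
  - exact: geodesic_start_neq.
  - by rewrite edge_sym.
  by rewrite eq_sym.
have [/existsP[y /and3P[x2y y1 y3]]|noy] := boolP [exists y,
    [&& edge (x 2) y, y != x 1 & y != x 3]]; last first.
  have only3 y : edge (x 2) y -> y != x 1 -> y = x 3.
    move=> x2y y1; apply: contraNeq noy => y3; apply/existsP; exists y.
    by rewrite x2y y1 y3.
  case/freeP: nfr2 => p q; rewrite !inE => /and3P[x2p _ p1] /and3P[x2q _ q1].
  by rewrite (only3 p x2p p1) (only3 q x2q q1) eqxx.
have fr1 : free (x 1 : detach (x 2)).
  apply/freeP=> p q; rewrite !inE => /and3P[xp _ p2] /and3P[xq _ q2] pq.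
  by apply/and3P; split=> //; have := clique1 p q xp xq p2 q2; rewrite (negPf pq).
have [t [pt nt lt_t]] := @branch_probes 2 y (x 1) d2 sep2 (sep (k := 3) d3) x2y y3
  (@geodesic_conn_left 1 2 d_gt1) y1 (n1 y x2y y1).
apply: (xi_del_probes _ pt nt); first exact: ltnW.
by have := num_free_detach2 nonfree2 nonfree1 neq12 fr1; move: lt_t; clear; lia.
Qed.

Lemma xi_del_separating : exists2 k, 0 < k < d & xi G <= xi (del_vertex (x k)).
Proof.
have [t [pt nt le_t]] := separating_probes.
have lt_f := num_free_detach1 nonfree1.
have [d_eq2|d_neq2] := eqVneq d 2.
  exists 1 => //; apply: (xi_del_probes _ pt nt); first exact: ltnW.
  by move: lt_f le_t; rewrite geq_max d_eq2; clear; lia.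
have d3 : 2 < d by rewrite ltn_neqAle eq_sym d_neq2.
have [/existsP[p /existsP[q /and5P[/andP[xp xq] p2 q2 pq npq]]]|Clique1] :=
  boolP [exists p, exists q, [&& edge (x 1) p && edge (x 1) q, p != x 2, q != x 2,
     p != q & ~~ edge p q]].
  by exists 1 => //; apply: (@xi_del_first p q).
have clique1 p q : edge (x 1) p -> edge (x 1) q -> p != x 2 -> q != x 2 ->
    (p == q) || edge p q.
  move=> xp xq p2 q2; move: Clique1; apply: contraNT; rewrite negb_or => /andP[pq npq].
  by apply/existsP; exists p; apply/existsP; exists q; rewrite xp xq p2 q2 pq.
have [fr2|nfr2] := boolP (free (x 2 : detach (x 1))); last first.
  by exists 2; last exact: xi_del_second.
exists 1 => //; apply: (xi_del_probes _ pt nt); first exact: ltnW.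
have := num_free_detach2 nonfree1 (geodesic_inner_nonfree (k := 2) d3) _ fr2.
rewrite eq_sym neq12 => /(_ isT).
by move: le_t; rewrite geq_max; clear; lia.
Qed.

End Separating.

Lemma xi_del_inner : exists2 k, 0 < k < d & xi G <= xi (del_vertex (x k)).
Proof.
have [/existsP[k /andP[kd cuw]]|/existsPn nsep] :=
  boolP [exists k : 'I_d, (0 < k) && conn (detach (x k)) u w].
  have {}kd : 0 < k < d by rewrite kd ltn_ord.
  by exists k; last exact: xi_del_nonseparating.
(* [w] separates itself from [u], because [detach w] isolates it. *)
apply: xi_del_separating => k /andP[k0].
rewrite leq_eqVlt => /orP[/eqP->|kd]; last first.
  by have := nsep (Ordinal kd); rewrite /= k0.
rewrite (@conn_sym (detach w)); apply: detach_disconnected.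
by rewrite eq_sym geodesic_neq // leqnn ltnW.
Qed.

End Diametral.

(** * Compatibility of [xi] *)

Theorem theorem3p4 : d_compatible xi.
Proof.
split=> [G t n|G noK]; first exact: xi_dunion_complete.
have [/existsP[a /existsP[b /andP[cab dab]]]|diam1] :=
    boolP [exists a : G, exists b : G, conn G a b && (1 < dist a b)]; last first.
  case: noK; apply: dunion_complete_of_diam1 => x y cxy; rewrite leqNgt.
  apply: contra diam1 => lt; apply/existsP; exists x.
  by apply/existsP; exists y; rewrite cxy.
have [u [w [s [_ ps span_s maxd]]]] := diam_sum_span_at a.
have d_gt1 : 1 < dist u w := leq_trans dab (maxd a b (connect0 _ _) cab).
have cuw : conn G u w by move: ps; rewrite probes_cons => /andP[].
have [x [x0 xd geo]] := geodesic_exists cuw.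
have [{}ps {}span_s] : probes ((x 0, x (dist u w)) :: s) /\
    span ((x 0, x (dist u w)) :: s) = diam_sum G by rewrite x0 xd.
have [k kd le_del] := xi_del_inner geo d_gt1 ps span_s.
exists (x k); split.
- exact: (geodesic_inner_nonfree geo kd).
- exact: le_del.
- exact: (xi_completion geo d_gt1 ps span_s kd).
by rewrite leq_subLR add1n (xi_completion_del geo d_gt1 ps span_s kd).
Qed.
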